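(* Let $p\ge3$ and let $\Gamma=\{\alpha^{(1)},\dots,\alpha^{(k)}\}$ be a set of minimal overlapping permutations in $S_p$, all starting with $1$, such that $\alpha^{(i)}$ and $\alpha^{(j)}$ are mutually minimal overlapping for all $1\le i<j\le k$. For each $i$ let $s_i$ be the last element of $\alpha^{(i)}$. Define $\mathrm{IU}_{\Gamma,n}(q,z)$ by \[ 1+\sum_{n\ge1}\mathrm{IU}_{\Gamma,n}(q,z)\frac{t^n}{[n]_q!}=\frac{1}{\mathrm{INM}_\Gamma(t,q,z)}, \] and set $\mathrm{IU}_{\Gamma,0}(q,z)=1$. Then $\mathrm{IU}_{\Gamma,1}(q,z)=-z$, and for $n\ge2$, \[ \mathrm{IU}_{\Gamma,n}(q,z)=(1-z)\,\mathrm{IU}_{\Gamma,n-1}(q,z)-\sum_{i=1}^k z^{\mathrm{des}(\alpha^{(i)})}q^{\mathrm{inv}(\alpha^{(i)})}\begin{bmatrix} n-s_i\\ p-s_i\end{bmatrix}_q\mathrm{IU}_{\Gamma,n-p+1}(q,z), \] where terms with $n<p$ are interpreted as $0$ (the $q$-binomial coefficient then vanishes).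
   Context: For $\sigma\in S_n$: $\mathrm{des}(\sigma)=|\{i:\sigma_i>\sigma_{i+1}\}|$, $\mathrm{inv}(\sigma)=|\{(i,k):i<k,\sigma_i>\sigma_k\}|$. $\mathrm{red}(w)$ replaces the $i$-th smallest entry of a sequence of distinct integers by $i$; for $\tau\in S_p$, $\sigma$ has a $\tau$-match at position $i$ if $\mathrm{red}(\sigma_i\cdots\sigma_{i+p-1})=\tau$, and a $\Gamma$-match if this reduction lies in $\Gamma$; $\mathcal{NM}_n(\Gamma)$ is the set of $\sigma\in S_n$ with no $\Gamma$-match. $\tau\in S_p$ is minimal overlapping if the smallest $i$ such that some $\sigma\in S_i$ has exactly two $\tau$-matches is $2p-1$. $\alpha,\beta\in S_p$ are mutually minimal overlapping if both are minimal overlapping and the smallest $n$ such that some $\sigma\in S_n$ has at least one $\alpha$-match and at least one $\beta$-match is $2p-1$. $[n]_q=1+q+\cdots+q^{n-1}$, $[n]_q!=[1]_q\cdots[n]_q$, $[0]_q!=1$, $\begin{bmatrix} m\\ k\end{bmatrix}_q=\frac{[m]_q!}{[k]_q![m-k]_q!}$ for $0\le k\le m$ and $0$ otherwise. $\mathrm{INM}_{\Gamma,n}(q,z)=\sum_{\sigma\in\mathcal{NM}_n(\Gamma)}z^{\mathrm{des}(\sigma)+1}q^{\mathrm{inv}(\sigma)}$ and $\mathrm{INM}_\Gamma(t,q,z)=1+\sum_{n\ge1}\frac{t^n}{[n]_q!}\mathrm{INM}_{\Gamma,n}(q,z)$. *)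

(* Defs.v *)
From HB Require Import structures.
From mathcomp Require Import all_boot all_order all_fingroup all_algebra.
Set Implicit Arguments.
Unset Strict Implicit.
Unset Printing Implicit Defensive.
Import GRing.Theory.
Local Open Scope nat_scope.

Definition is_least (P : nat -> Prop) (n : nat) : Prop :=
  P n /\ forall m, P m -> n <= m.

(* One-line notation, with values 1, ..., n as on paper ('I_n starts at 0). *)
Definition word (n : nat) (s : 'S_n) : seq nat :=
  [seq (s i).+1 | i <- enum 'I_n].

Definition n_descents (n : nat) (s : 'S_n) : nat :=
  #|[set i : 'I_n | (i.+1 < n) && (nth 0 (word s) i > nth 0 (word s) i.+1)]|.

Definition n_inversions (n : nat) (s : 'S_n) : nat :=
  #|[set ik : 'I_n * 'I_n | (ik.1 < ik.2) && (s ik.1 > s ik.2)]|.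

(* The i-th smallest entry x of a duplicate-free w has exactly i entries <= x. *)
Definition red (w : seq nat) : seq nat :=
  [seq count (fun y => y <= x) w | x <- w].

(* Positions are numbered from 0. *)
Definition is_match (p n : nat) (tau : 'S_p) (s : 'S_n) (i : nat) : bool :=
  (i + p <= n) && (red (take p (drop i (word s))) == word tau).

Definition n_matches (p n : nat) (tau : 'S_p) (s : 'S_n) : nat :=
  #|[set i : 'I_n.+1 | is_match tau s i]|.

Definition is_set_match (p n : nat) (Gamma : {set 'S_p}) (s : 'S_n) (i : nat)
    : bool :=
  [exists tau in Gamma, is_match tau s i].

Definition NM (p : nat) (Gamma : {set 'S_p}) (n : nat) : {set 'S_n} :=
  [set s : 'S_n | [forall i : 'I_n.+1, ~~ is_set_match Gamma s i]].

Definition minimal_overlapping (p : nat) (tau : 'S_p) : Prop :=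
  is_least (fun n => exists s : 'S_n, n_matches tau s = 2) (2 * p - 1).

Definition mutually_minimal_overlapping (p : nat) (alpha beta : 'S_p) : Prop :=
  [/\ minimal_overlapping alpha, minimal_overlapping beta &
      is_least (fun n => exists s : 'S_n,
                  (1 <= n_matches alpha s) /\ (1 <= n_matches beta s))
               (2 * p - 1)].

Local Open Scope ring_scope.

(* Formal power series in t are represented by their coefficient sequences. *)
Definition fps_mul (K : fieldType) (f g : nat -> K) (n : nat) : K :=
  \sum_(i < n.+1) f (n - i)%N * g i.

(* The first n coefficients of 1 / f, by the usual recursion. *)
Fixpoint fps_inv_prefix (K : fieldType) (f : nat -> K) (n : nat) : seq K :=
  if n is m.+1 then
    let s := fps_inv_prefix f m in
    rcons s ((f 0%N)^-1 * ((m == 0%N)%:R - \sum_(i < m) f (m - i)%N * s`_i))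
  else [::].

Definition fps_inv (K : fieldType) (f : nat -> K) (n : nat) : K :=
  (fps_inv_prefix f n.+1)`_n.

Lemma size_fps_inv_prefix (K : fieldType) (f : nat -> K) (n : nat) :
  size (fps_inv_prefix f n) = n.
Proof. by elim: n => //= n IHn; rewrite size_rcons IHn. Qed.

Lemma fps_inv_prefixE (K : fieldType) (f : nat -> K) (n i : nat) :
  (i < n)%N -> (fps_inv_prefix f n)`_i = fps_inv f i.
Proof.
elim: n => // n IHn; rewrite ltnS leq_eqVlt => /orP[/eqP -> //|lt_in].
by rewrite /= nth_rcons size_fps_inv_prefix lt_in IHn.
Qed.

Lemma fps_mulV (K : fieldType) (f : nat -> K) (n : nat) :
  f 0%N != 0 -> fps_mul f (fps_inv f) n = (n == 0%N)%:R.
Proof.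
move=> f0; rewrite /fps_mul big_ord_recr /= subnn {2}/fps_inv /=.
rewrite nth_rcons size_fps_inv_prefix ltnn eqxx mulrA mulfV // mul1r.
under [X in _ + (_ - X)]eq_bigr => i _ do rewrite fps_inv_prefixE //.
by rewrite addrC subrK.
Qed.

Definition qint (K : fieldType) (q : K) (n : nat) : K := \sum_(i < n) q ^+ i.

Definition qfact (K : fieldType) (q : K) (n : nat) : K :=
  \prod_(1 <= i < n.+1) qint q i.

Definition qbinom (K : fieldType) (q : K) (m k : nat) : K :=
  if (k <= m)%N then qfact q m / (qfact q k * qfact q (m - k)) else 0.

Definition INM (K : fieldType) (q z : K) (p : nat) (Gamma : {set 'S_p})
    (n : nat) : K :=
  \sum_(s in NM Gamma n) z ^+ (n_descents s + 1) * q ^+ n_inversions s.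

Definition INM_series (K : fieldType) (q z : K) (p : nat) (Gamma : {set 'S_p})
    (n : nat) : K :=
  if n == 0%N then 1 else INM q z Gamma n / qfact q n.

(* The coefficient of t ^ n / [n]_q! in 1 / INM; see IU0 and IU_series. *)
Definition IU (K : fieldType) (q z : K) (p : nat) (Gamma : {set 'S_p})
    (n : nat) : K :=
  fps_inv (INM_series q z Gamma) n * qfact q n.

Lemma IU0 (K : fieldType) (q z : K) (p : nat) (Gamma : {set 'S_p}) :
  IU q z Gamma 0 = 1.
Proof.
by rewrite /IU /fps_inv /= /INM_series /qfact big_geq // big_ord0 subr0 invr1 !mulr1.
Qed.

Lemma IU_series (K : fieldType) (q z : K) (p : nat) (Gamma : {set 'S_p})
    (n : nat) :
  (forall m, qfact q m != 0) ->
  fps_mul (INM_series q z Gamma) (fun m => IU q z Gamma m / qfact q m) n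
  = (n == 0%N)%:R.
Proof.
move=> nz; rewrite -(@fps_mulV _ (INM_series q z Gamma)) ?oner_eq0 //.
by apply: eq_bigr => i _; rewrite /IU mulfK.
Qed.

(* The field Q(q, z), with q and z independent indeterminates. *)
Definition Qqz : fieldType := {fraction {poly {poly rat}}}.
Definition q_ : Qqz := tofrac ('X%:P).
Definition z_ : Qqz := tofrac 'X.

(* So that IU_series applies with q := q_. *)
Lemma qfact_q_neq0 (n : nat) : qfact q_ n != 0.
Proof.
rewrite /qfact prodf_seq_neq0; apply/allP => -[|m]; rewrite mem_index_iota //= => _.
have -> : qint q_ m.+1 = tofrac ((\sum_(i < m.+1) 'X^i)%:P).
  rewrite /qint rmorph_sum /= rmorph_sum /=; apply: eq_bigr => i _.
  by rewrite !rmorphXn.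
rewrite tofrac_eq0 polyC_eq0; apply/eqP => /(congr1 (fun u : {poly rat} => u`_0)).
rewrite coef_sum coef0 big_ord_recl coefXn eqxx big1 => [|i _].
  by move/eqP; rewrite addr0 oner_eq0.
by rewrite coefXn.
Qed.

(* Main.v *)
(* This is a cluster expansion. Expand a descent position as z, and an ascent
   position as z + (1 - z), where 1 - z marks the ascent; exclude the patterns
   of Gamma by inclusion-exclusion over marked occurrences. Two occurrences share
   at most one letter, so a permutation decomposes into consecutive chains, whose
   tiles are marked ascents and marked occurrences glued at their end points.
   With C_n the q-weight of the chains on n letters this gives
   INM = 1 / (1 - z * sum_n C_n t ^ n / [n]_q!), hence IU_n = - z * C_n.
   Since every tile starts with its least letter, so does every chain, and the
   recurrence comes from removing the first tile: a marked ascent leaves a chain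
   on n - 1 letters, while an occurrence of alpha forces its last letter to have
   the value s, so that only the p - s larger letters of the occurrence are
   chosen, among n - s. *)
Require Import Defs.
From HB Require Import structures.
From mathcomp Require Import all_boot all_order all_fingroup all_algebra.
From mathcomp Require Import zify ring.
Set Implicit Arguments.
Unset Strict Implicit.
Unset Printing Implicit Defensive.
Import GRing.Theory.
Local Open Scope ring_scope.

(** * Functions of words that see only the relative order of the letters *)

Definition order_invariant (A : Type) (F : seq nat -> A) : Prop :=
  forall h w, {in w &, {mono h : x y / (x <= y)%N}} -> F (map h w) = F w.

Definition insert_at (j a : nat) (w : seq nat) : seq nat :=
  take j w ++ a :: drop j w.

Lemma mem_insert_at j a w x :
  (x \in insert_at j a w) = (x == a) || (x \in w).
Proof.
by rewrite -{2}(cat_take_drop j w) mem_cat inE mem_cat orbCA.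
Qed.

Lemma map_insert_at h j a w :
  map h (insert_at j a w) = insert_at j (h a) (map h w).
Proof. by rewrite /insert_at map_cat /= map_take map_drop. Qed.

Lemma order_invariant_map (A : Type) (F : seq nat -> A) h :
  {mono h : x y / (x <= y)%N} -> order_invariant F -> forall w, F (map h w) = F w.
Proof. by move=> mh iF w; apply: iF => x y _ _; apply: mh. Qed.

Lemma order_invariant_comp_map (A : Type) (F : seq nat -> A) h :
  {mono h : x y / (x <= y)%N} -> order_invariant F ->
  order_invariant (fun w => F (map h w)).
Proof. by move=> mh iF g w mg; rewrite !(order_invariant_map mh iF); apply: iF. Qed.

Lemma order_invariant_insert0 (A : Type) (F : seq nat -> A) j :
  order_invariant F -> order_invariant (fun w => F (insert_at j 0 (map S w))).
Proof.
move=> iF h w mh; pose h' x := if x is x'.+1 then (h x').+1 else 0%N.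
rewrite -[RHS](iF h') => [|x y].
  by rewrite map_insert_at -!map_comp.
rewrite !mem_insert_at => /orP[/eqP->|/mapP[x' wx ->]] //.
by move=> /orP[/eqP->|/mapP[y' wy ->]] //=; rewrite !ltnS mh.
Qed.

(** * Sums over words weighted by inversions *)

Section WordSum.

Variables (K : fieldType) (q : K).

(* The sum of q ^ inv(w) * f w over the words w of k distinct letters among
   0, ..., n - 1, where inv(w) also counts the letters that are missing from w as
   if they came after it. The first letter i then has i inversions, and bump i
   relabels the rest of the word. *)
Fixpoint word_sum (n k : nat) (f : seq nat -> K) : K :=
  if k is k'.+1 then
    \sum_(i < n) q ^+ i * word_sum n.-1 k' (fun w => f (val i :: map (bump i) w))
  else f [::].

Lemma word_sumS n k f :
  word_sum n k.+1 f
  = \sum_(i < n) q ^+ i * word_sum n.-1 k (fun w => f (val i :: map (bump i) w)).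
Proof. by []. Qed.

Lemma bump_mono i : {mono bump i : x y / (x <= y)%N}.
Proof. by move=> x y; rewrite leq_bump2. Qed.

Lemma eq_word_sum n k f g :
  (forall w, size w = k -> uniq w -> all (fun x => x < n)%N w -> f w = g w) ->
  word_sum n k f = word_sum n k g.
Proof.
elim: k n f g => [|k IHk] n f g efg /=; first exact: efg.
apply: eq_bigr => i _; congr (_ * _); apply: IHk => w sz_w Uw ltw.
have lt_in := ltn_ord i.
apply: efg; rewrite /= ?size_map ?sz_w //.
  rewrite map_inj_uniq ?Uw ?andbT; last exact: can_inj (bumpK i).
  by apply/mapP => -[x _]; rewrite /bump; lia.
rewrite lt_in all_map; apply: sub_all ltw => x /=; rewrite /bump; lia.
Qed.

Lemma word_sumD n k f g :
  word_sum n k (fun w => f w + g w) = word_sum n k f + word_sum n k g.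
Proof.
elim: k n f g => //= k IHk n f g; rewrite -big_split; apply: eq_bigr => i _.
by rewrite IHk mulrDr.
Qed.

Lemma word_sumZ n k a f :
  word_sum n k (fun w => a * f w) = a * word_sum n k f.
Proof.
elim: k n f => //= k IHk n f; rewrite mulr_sumr; apply: eq_bigr => i _.
by rewrite IHk mulrCA.
Qed.

Lemma word_sum0 n k : word_sum n k (fun=> 0) = 0.
Proof. by elim: k n => //= k IHk n; rewrite big1 // => i _; rewrite IHk mulr0. Qed.

Lemma word_sum_sum (I : Type) (r : seq I) (P : pred I) n k (f : I -> seq nat -> K) :
  word_sum n k (fun w => \sum_(i <- r | P i) f i w)
  = \sum_(i <- r | P i) word_sum n k (f i).
Proof.
elim: r => [|i r IHr].
  rewrite big_nil -[RHS](word_sum0 n k).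
  by apply: eq_word_sum => w _ _ _; rewrite big_nil.
rewrite big_cons -IHr; case: ifP => Pi; rewrite -?word_sumD;
  by apply: eq_word_sum => w _ _ _; rewrite big_cons Pi.
Qed.

Lemma word_sum_gt n k f : (n < k)%N -> word_sum n k f = 0.
Proof.
elim: k n f => // k IHk [|n] f lt_nk /=; first by rewrite big_ord0.
by rewrite big1 // => i _; rewrite IHk ?mulr0.
Qed.

(** The weight of the first [k] letters already includes their inversions with all later ones. What
    follows is an arbitrary word on the other [n - k] letters, and [G] does not notice their
    relabelling. *)
Lemma word_sum_take_drop n k F G : (k <= n)%N -> order_invariant G ->
  word_sum n n (fun w => F (take k w) * G (drop k w))
  = word_sum n k F * word_sum (n - k) (n - k) G.
Proof.
move=> le_kn iG; elim: k n F le_kn => [|k IHk] n F le_kn.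
  rewrite subn0 -word_sumZ; apply: eq_word_sum => w _ _ _.
  by rewrite take0 drop0.
case: n le_kn => // n le_kn.
rewrite [in LHS]/= [word_sum n.+1 k.+1 F]/= subSS mulr_suml; apply: eq_bigr => i _ /=.
rewrite -mulrA -IHk //; congr (_ * _); apply: eq_word_sum => w _ _ _.
by rewrite map_take -map_drop (order_invariant_map (@bump_mono i) iG).
Qed.

Arguments word_sum : simpl never.

(* The letter 0 of a word on {0, ..., n}, placed at position j, has j inversions. *)
Lemma word_sum_min n k F :
  word_sum n.+1 k.+1 F
  = q ^+ k.+1 * word_sum n k.+1 (fun w => F (map S w))
    + \sum_(j < k.+1) q ^+ j * word_sum n k (fun w => F (insert_at j 0 (map S w))).
Proof.
elim: k n F => [|k IHk] n F.
  rewrite !word_sumS big_ord_recl big_ord1 addrC; congr (_ + _).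
  rewrite mulr_sumr; apply: eq_bigr => i _.
  by rewrite expr1 mulrA -exprS.
(* A first letter 0 is the insertion at [j] = 0. After a first letter [i.+1], the induction
   hypothesis splits the tail by its letter 0. *)
rewrite word_sumS big_ord_recl [in RHS]big_ord_recl [RHS]addrCA; congr (_ + _).
case: n => [|n].
  rewrite big_ord0 word_sum_gt // mulr0 add0r big1 // => i _.
  by rewrite word_sum_gt ?mulr0.
transitivity (\sum_(i < n.+1) q ^+ i.+1 *
   (q ^+ k.+1 * word_sum n k.+1 (fun w => F (i.+1 :: map (bump i.+1) (map S w)))
    + \sum_(j < k.+1) q ^+ j *
       word_sum n k (fun w => F (i.+1 :: map (bump i.+1) (insert_at j 0 (map S w)))))).
  by apply: eq_bigr => i _; rewrite lift0 -pred_Sn IHk.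
have bumpSS i w : map (bump i.+1) (map S w) = map S (map (bump i) w).
  by rewrite -!map_comp; apply: eq_map => x /=; rewrite bumpS.
under eq_bigr do rewrite mulrDr; rewrite big_split /=; congr (_ + _).
  rewrite word_sumS mulr_sumr; apply: eq_bigr => i _.
  rewrite mulrA -exprD addSnnS addnC exprD -mulrA; congr (_ * (_ * _)).
  by apply: eq_word_sum => w _ _ _; rewrite bumpSS.
under eq_bigr do rewrite mulr_sumr; rewrite exchange_big; apply: eq_bigr => j _.
rewrite word_sumS mulr_sumr; apply: eq_bigr => i _ /=.
rewrite !mulrA -!exprD addnC addSnnS; congr (_ * _).
apply: eq_word_sum => w _ _ _; rewrite map_insert_at bumpSS.
by rewrite /insert_at /= /bump.
Qed.

End WordSum.

Lemma count_insert_at (a : pred nat) j x w :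
  count a (insert_at j x w) = (a x + count a w)%N.
Proof. by rewrite -{2}(cat_take_drop j w) !count_cat /= addnCA. Qed.

Lemma perm_insert_at j x w : perm_eq (insert_at j x w) (x :: w).
Proof. by apply/seq.permP => a; rewrite count_insert_at. Qed.

Lemma size_insert_at j x w : size (insert_at j x w) = (size w).+1.
Proof. exact: perm_size (perm_insert_at j x w). Qed.

Lemma uniq_insert0 j w : uniq w -> uniq (insert_at j 0 (map S w)).
Proof.
move=> Uw; rewrite (perm_uniq (perm_insert_at _ _ _)) /= map_inj_uniq ?Uw ?andbT.
  by apply/mapP => -[].
exact: succn_inj.
Qed.

Lemma last_insert0 j w :
  last 0%N (insert_at j 0 (map S w)) = if (j < size w)%N then (last 0%N w).+1 else 0%N.
Proof.
rewrite /insert_at last_cat -map_drop /=; case: ltnP => [lt_jw|le_wj].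
  rewrite -{2}(cat_take_drop j w) last_cat (drop_nth 0%N lt_jw) /=.
  by rewrite (last_map S).
by rewrite drop_oversize.
Qed.

Lemma count_ltn_uniq w x : uniq w -> (count (fun y => y < x) w <= x)%N.
Proof.
move=> Uw; rewrite -size_filter -[leqRHS](size_iota 0).
by apply: uniq_leq_size => [|y]; rewrite ?filter_uniq // mem_filter mem_iota => /andP[].
Qed.

(** * q-binomial coefficients as weights of sets of letters *)

Section QBinomial.

Variables (K : fieldType) (q : K).
Hypothesis qfact_neq0 : forall n, qfact q n != 0.

Lemma qint_add m n : qint q (m + n) = qint q m + q ^+ m * qint q n.
Proof.
rewrite /qint big_split_ord mulr_sumr /=; congr (_ + _).
by apply: eq_bigr => i _; rewrite exprD.
Qed.

Lemma qfactS n : qfact q n.+1 = qfact q n * qint q n.+1.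
Proof. by rewrite /qfact big_nat_recr. Qed.

Lemma qfact0 : qfact q 0 = 1.
Proof. by rewrite /qfact big_geq. Qed.

Lemma qint_neq0 n : qint q n.+1 != 0.
Proof. by have := qfact_neq0 n.+1; rewrite qfactS mulf_eq0 negb_or => /andP[]. Qed.

Lemma qbinom_pascal n k :
  qbinom q n.+1 k.+1 = q ^+ k.+1 * qbinom q n k.+1 + qbinom q n k.
Proof.
rewrite /qbinom ltnS; case: (ltngtP k n) => [lt_kn|_|->]; last 2 first.
- by rewrite mulr0 addr0.
- by rewrite mulr0 add0r !subnn qfact0 !mulr1 !mulfV.
have -> : (n.+1 - k.+1 = (n - k.+1).+1)%N by lia.
have -> : (n - k = (n - k.+1).+1)%N by lia.
set m := (n - k.+1)%N; rewrite !qfactS.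
have -> : n.+1 = (k.+1 + m.+1)%N by rewrite /m; lia.
rewrite qint_add.
have [nk nm] := (qfact_neq0 k, qfact_neq0 m).
have [ik im] := (qint_neq0 k, qint_neq0 m).
by field; rewrite nk nm ik im.
Qed.

Lemma qbinom0 n : qbinom q n 0 = 1.
Proof. by rewrite /qbinom subn0 qfact0 mul1r mulfV. Qed.

Lemma qbinom_gt n k : (n < k)%N -> qbinom q n k = 0.
Proof. by rewrite /qbinom ltnNge => /negPf->. Qed.

(** Splitting by whether the letter 0 occurs reproduces Pascal's rule. *)
Lemma word_sum_qbinom n k (F : seq nat -> K) : order_invariant F ->
  word_sum q n k F = qbinom q n k * word_sum q k k F.
Proof.
elim: n k F => [|n IHn] [|k] F iF; rewrite ?qbinom0 ?mul1r //.
  by rewrite qbinom_gt // mul0r word_sum_gt.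
have iFS : order_invariant (fun w => F (map S w)) by apply: order_invariant_comp_map.
have FS k' : word_sum q k' k.+1 (fun w => F (map S w)) = word_sum q k' k.+1 F.
  by apply: eq_word_sum => w _ _ _; rewrite order_invariant_map.
rewrite qbinom_pascal word_sum_min FS IHn // mulrDl mulrA; congr (_ + _).
rewrite word_sum_min word_sum_gt // mulr0 add0r mulr_sumr; apply: eq_bigr => j _.
rewrite IHn; first by rewrite mulrCA.
exact: order_invariant_insert0.
Qed.

(** Where [F] is nonzero, a last letter of value [v] has exactly [v] smaller letters in the word, so
    all of these occur. Only the [k - v.+1] larger letters are chosen, among [n - v.+1]. The
    induction on [v] removes the letter 0. *)
Lemma word_sum_last n k v (F : seq nat -> K) :
    order_invariant F ->
    (forall w, size w = k -> uniq w -> F w != 0 ->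
       count (fun x => x < last 0 w)%N w = v) ->
    (v < k <= n)%N ->
  word_sum q n k (fun w => if last 0%N w == v then F w else 0)
  = qbinom q (n - v.+1) (k - v.+1) * word_sum q k k F.
Proof.
elim: v n k F => [|v IHv] [|n] [|k] F iF rF; rewrite ?andbF ?ltn0 // => /andP[lt_vk le_kn].
  have sI j w : size w = k -> size (insert_at j 0 (map S w)) = k.+1.
    by rewrite size_insert_at size_map => ->.
  have UI := uniq_insert0.
  rewrite word_sum_min.
  rewrite (@eq_word_sum _ _ _ _ _ (fun=> 0)) ?word_sum0 ?mulr0 ?add0r; last first.
    by case=> // x w _ _ _; rewrite /= (last_map S).
  rewrite [word_sum q k.+1 _ _]word_sum_min word_sum_gt // mulr0 add0r.
  rewrite !subn1 mulr_sumr /=; apply: eq_bigr => j _; rewrite mulrCA; congr (_ * _).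
  rewrite -word_sum_qbinom; last exact: order_invariant_insert0.
  apply: eq_word_sum => w sw Uw _; rewrite last_insert0.
  case: ltnP => // lt_jw; apply/esym/eqP; apply: contraT => /(rF _ (sI j w sw) (UI j w Uw)).
  by rewrite count_insert_at last_insert0 lt_jw.
have sI j w : size w = k -> size (insert_at j 0 (map S w)) = k.+1.
  by rewrite size_insert_at size_map => ->.
have UI := uniq_insert0.
rewrite word_sum_min.
(* Without the letter 0, a last letter [v.+1] has at most [v] smaller letters, against its rank
   [v.+1]. *)
rewrite (@eq_word_sum _ _ _ _ _ (fun=> 0)) ?word_sum0 ?mulr0 ?add0r; last first.
  case=> // x w sw Uw _; cbv beta; rewrite (order_invariant_map _ iF) //.
  rewrite /= (last_map S); case: eqP => // -[def_v].
  apply/eqP; apply: contraT => /(rF _ sw Uw) /= rw.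
  have := count_ltn_uniq (last x w) Uw; rewrite /= rw def_v; lia.
rewrite [word_sum q k.+1 _ _]word_sum_min word_sum_gt // mulr0 add0r !subSS.
rewrite mulr_sumr; apply: eq_bigr => j _; rewrite mulrCA; congr (_ * _).
have [lt_jk|le_kj] := ltnP j k.
  rewrite -IHv; first 1 last.
  - exact: order_invariant_insert0.
  - move=> w sw Uw /(rF _ (sI j w sw) (UI j w Uw)).
    rewrite count_insert_at last_insert0 sw lt_jk add1n => -[<-].
    by rewrite count_map; apply: eq_count.
  - exact/andP.
  by apply: eq_word_sum => w sw Uw _; rewrite last_insert0 sw lt_jk eqSS.
(* With 0 at the end the last letter has rank 0, not [v.+1], so both sides vanish. *)
have jk : (j < k)%N = false by rewrite ltnNge le_kj.
rewrite !(@eq_word_sum _ _ _ _ _ (fun=> 0)) ?word_sum0 ?mulr0 // => w sw Uw _.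
  apply/eqP; apply: contraT => /(rF _ (sI j w sw) (UI j w Uw)).
  by rewrite count_insert_at last_insert0 sw jk /= count_pred0.
by rewrite last_insert0 sw jk.
Qed.

End QBinomial.

(** * Permutations as words, built from their first letter *)

Lemma n_inversionsE n (s : 'S_n) :
  n_inversions s = (\sum_(a < n) \sum_(b < n) ((a < b) && (s b < s a)))%N.
Proof.
rewrite /n_inversions -sum1dep_card big_mkcond /= pair_bigA /=.
by apply: eq_bigr => -[a b] _ /=; case: ifP.
Qed.

(** The first letter [i] exceeds exactly [i] others, all later; lifting past the value [i] keeps the
    order of the rest. *)
Lemma n_inversions_lift n i (s : 'S_n) :
  n_inversions (lift_perm ord0 i s) = (i + n_inversions s)%N.
Proof.
rewrite !n_inversionsE big_ord_recl; congr (_ + _)%N.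
  rewrite big_ord_recl /= add0n.
  under eq_bigr => b _ do rewrite lift_perm_id lift_perm_lift /=.
  rewrite -(reindex_inj (@perm_inj _ s) (P := predT)
    (F := fun c : 'I_n => nat_of_bool (bump i c < i)%N)) /=.
  transitivity (\sum_(c < n | (c < i)%N) 1)%N.
    rewrite [RHS]big_mkcond; apply: eq_bigr => c _; rewrite /bump.
    by case: (ltnP c i) => [lt_ci|le_ic]; lia.
  by rewrite -(big_ord_widen _ (fun=> 1%N)) ?sum1_card ?card_ord // -ltnS.
apply: eq_bigr => a _; rewrite big_ord_recl /= add0n; apply: eq_bigr => b _.
rewrite !lift_perm_lift /= [(bump i _ < _)%N]ltnNge leq_bump2 -ltnNge.
by rewrite /bump /= !add1n ltnS.
Qed.

Lemma word_lift n i (s : 'S_n) :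
  word (lift_perm ord0 i s) = i.+1 :: map (bump i.+1) (word s).
Proof.
rewrite /word enum_ordSl /= lift_perm_id -!map_comp; congr (_ :: _).
by apply: eq_map => k /=; rewrite lift_perm_lift bumpS.
Qed.

Lemma lift_perm_bij n :
  bijective (fun u : 'I_n.+1 * 'S_n => lift_perm ord0 u.1 u.2).
Proof.
apply: inj_card_bij => [[i s] [j t] /= eq_st|].
  have eq_ij : i = j by rewrite -(lift_perm_id ord0 i s) eq_st lift_perm_id.
  congr (_, _) => //; apply/permP => k; apply: (@lift_inj _ i).
  by rewrite -(lift_perm_lift ord0) eq_st lift_perm_lift eq_ij.
by rewrite card_prod card_ord !card_Sn factS.
Qed.

Lemma sum_perm_word (K : fieldType) (q : K) n f :
  \sum_(s : 'S_n) q ^+ n_inversions s * f (word s)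
  = word_sum q n n (fun w => f (map S w)).
Proof.
elim: n f => [|n IHn] f.
  rewrite (big_pred1 1%g) => [|s]; last first.
    by apply/esym/eqP/permP => -[].
  rewrite n_inversionsE big_ord0 mul1r /word /= enum_ord0.
  by [].
rewrite (reindex _ (onW_bij _ (lift_perm_bij n))) word_sumS.
rewrite -(pair_bigA _ (fun i s =>
  q ^+ n_inversions (lift_perm ord0 i s) * f (word (lift_perm ord0 i s)))) /=.
apply: eq_bigr => i _.
transitivity (q ^+ i * \sum_(s : 'S_n)
    q ^+ n_inversions s * f (i.+1 :: map (bump i.+1) (word s))).
  rewrite mulr_sumr; apply: eq_bigr => s _.
  by rewrite n_inversions_lift word_lift exprD mulrA.
rewrite (IHn (fun w => f (i.+1 :: map (bump i.+1) w))); congr (_ * _).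
apply: eq_word_sum => w _ _ _; rewrite -!map_comp; congr (f (_ :: _)).
by apply: eq_map => x /=; rewrite bumpS.
Qed.

(** * Reduction of words *)

Lemma red_order_invariant : order_invariant red.
Proof.
move=> h w mh; rewrite /red -map_comp; apply/eq_in_map => x wx /=.
by rewrite count_map; apply/eq_in_count => y wy /=; rewrite mh.
Qed.

(** Hence [red] is one of the relabellings allowed in [order_invariant]. *)
Lemma red_mono u :
  {in u &, {mono (fun x => count (fun y => y <= x)%N u) : x y / (x <= y)%N}}.
Proof.
move=> x y ux uy /=; case: (leqP x y) => [le_xy|lt_yx].
  by apply: sub_count => t /= /leq_trans; apply.
apply/negbTE; rewrite -ltnNge.
have -> : count (fun t => t <= x)%N u
        = (count (fun t => t <= y) u + count (fun t => y < t <= x) u)%N.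
  by elim: u {ux uy} => //= t u ->; lia.
by rewrite -addn1 leq_add2l -has_count; apply/hasP; exists x; rewrite ?lt_yx ?leqnn.
Qed.

Lemma order_invariant_red (A : Type) (F : seq nat -> A) u :
  order_invariant F -> F (red u) = F u.
Proof. by move=> iF; apply: iF (@red_mono u). Qed.

Lemma count_leq_ltn u x : uniq u -> x \in u ->
  count (fun y => y <= x)%N u = (count (fun y => y < x)%N u).+1.
Proof.
move=> Uu ux; have c1 : count (pred1 x) u = 1%N by rewrite count_uniq_mem ?ux.
rewrite -addn1 -[in RHS]c1 -count_predUI.
rewrite [count (predI _ _) _](eq_count (a2 := pred0)) => [|y /=].
  by rewrite count_pred0 addn0; apply: eq_count => y /=; lia.
by case: (ltngtP y x).
Qed.

Lemma perm_eq_iota n w : size w = n -> uniq w -> all (fun x => x < n)%N w ->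
  perm_eq w (iota 0 n).
Proof.
move=> sw Uw ltw; apply: uniq_perm; rewrite ?iota_uniq //.
apply: (uniq_min_size Uw _ _).2; rewrite ?size_iota ?sw // => x /(allP ltw).
by rewrite mem_iota.
Qed.

Lemma count_ltn_iota n x : (x <= n)%N -> count (fun y => y < x)%N (iota 0 n) = x.
Proof. by move=> le_xn; rewrite -size_filter (filter_iota_ltn 0) ?size_iota. Qed.

Lemma size_word n (s : 'S_n) : size (word s) = n.
Proof. by rewrite size_map size_enum_ord. Qed.

Lemma nth_word n (s : 'S_n) (i : 'I_n) : nth 0%N (word s) i = (s i).+1.
Proof. by rewrite (nth_map i) ?size_enum_ord // nth_ord_enum. Qed.

Lemma word_inj n : injective (@word n).
Proof.
move=> s t eq_st; apply/permP => i; apply/val_inj/succn_inj.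
by rewrite -!nth_word eq_st.
Qed.

Lemma perm_word n (s : 'S_n) : perm_eq (word s) (map S (iota 0 n)).
Proof.
rewrite /word (map_comp S (fun i => val (s i))); apply: perm_map; apply: perm_eq_iota.
- by rewrite size_map size_enum_ord.
- by rewrite map_inj_uniq ?enum_uniq // => i j /val_inj/perm_inj.
- by apply/allP => _ /mapP[i _ ->]; apply: ltn_ord.
Qed.

Lemma red_word n (s : 'S_n) : red (word s) = word s.
Proof.
rewrite /red -[RHS]map_id; apply/eq_in_map => x; rewrite (perm_mem (perm_word s)).
case/mapP => y; rewrite mem_iota => lt_yn ->.
rewrite (seq.permP (perm_word s)) count_map -[RHS](@count_ltn_iota n y.+1) //.
Qed.

(** This turns a window of a longer word into a permutation, to which the overlap hypotheses apply.
    The permutation sends a position to the number of letters smaller than the one there. *)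
Lemma red_is_word m u : size u = m -> uniq u -> exists s : 'S_m, word s = red u.
Proof.
move=> su Uu; pose rk (i : 'I_m) := count (fun y => y < nth 0 u i)%N u.
have u_i (i : 'I_m) : nth 0%N u i \in u by rewrite mem_nth ?su.
have lt_rk i : (rk i < m)%N.
  by rewrite -count_leq_ltn // -[leqRHS]su count_size.
have inj_rk : injective (fun i => Ordinal (lt_rk i)).
  move=> i j /(congr1 val) /= eq_ij; apply/val_inj/eqP.
  have lt_i (k : 'I_m) : (k < size u)%N by rewrite su.
  rewrite -(nth_uniq 0%N (lt_i i) (lt_i j) Uu) eqn_leq -!(red_mono (u_i _) (u_i _)).
  by rewrite !count_leq_ltn // -/(rk _) -/(rk _) eq_ij leqnn.
exists (perm inj_rk); apply: (@eq_from_nth _ 0%N); first by rewrite size_word size_map.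
move=> i; rewrite size_word => lt_im; rewrite (nth_word _ (Ordinal lt_im)) permE /=.
by rewrite (nth_map 0%N) ?su // count_leq_ltn //; apply: (u_i (Ordinal lt_im)).
Qed.

(** The default [x] of [head] keeps the last letter from counting as a descent. *)
Fixpoint descents (w : seq nat) : nat :=
  if w is x :: r then ((head x r < x) + descents r)%N else 0%N.

Lemma descents_order_invariant : order_invariant descents.
Proof.
move=> h; elim=> //= x r IHr mh; rewrite IHr => [|a b ra rb]; last first.
  by rewrite mh // inE ?ra ?rb orbT.
congr (_ + _)%N; case: r mh {IHr} => [|y r] mh /=; first by rewrite !ltnn.
by rewrite !ltnNge mh // !inE eqxx ?orbT.
Qed.

(** The pieces share the letter at position [m], so each adjacency lies in exactly one of them. *)
Lemma descents_split m w : (m < size w)%N ->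
  descents w = (descents (take m.+1 w) + descents (drop m w))%N.
Proof.
elim: m w => [|m IHm] [|x r] //=; first by rewrite take0 /= ltnn.
by rewrite ltnS => lt_mr; rewrite [in LHS]IHm // addnA; case: r lt_mr.
Qed.

Lemma n_descents_word n (s : 'S_n) : n_descents s = descents (word s).
Proof.
rewrite /n_descents -sum1dep_card big_mkcond /=.
have := size_word s; move: (word s) => w {s}.
elim: w n => [|x r IHr] [] //=; first by rewrite big_ord0.
move=> m [sr]; rewrite big_ord_recl /= -(IHr m) //; congr (_ + _)%N.
by case: r {IHr} sr => [|y r] <- /=; rewrite ?ltnn //; case: ifP.
Qed.

(** * Occurrences of a pattern at the start of a word *)

Definition begins (p : nat) (tau : 'S_p) (w : seq nat) : bool :=
  red (take p w) == word tau.

Lemma begins_size p (tau : 'S_p) w : begins tau w -> (p <= size w)%N.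
Proof.
by move/eqP/(congr1 size); rewrite size_map size_word size_take; case: ltnP => [/ltnW|_ ->].
Qed.

Lemma begins_take p (tau : 'S_p) w k :
  begins tau (take k w) = (p <= k)%N && begins tau w.
Proof.
case: (leqP p k) => [le_pk|lt_kp]; first by rewrite /begins take_takel.
apply: contraTF lt_kp => /begins_size; rewrite -leqNgt size_take.
by case: ltnP; lia.
Qed.

Lemma sub_mono h (u w : seq nat) : {subset u <= w} ->
  {in w &, {mono h : x y / (x <= y)%N}} -> {in u &, {mono h : x y / (x <= y)%N}}.
Proof. by move=> uw mh x y /uw wx /uw wy; apply: mh. Qed.

Lemma begins_order_invariant p (tau : 'S_p) : order_invariant (begins tau).
Proof.
move=> h w mh; rewrite /begins -map_take red_order_invariant //.
exact: sub_mono (@mem_take _ _ _) mh.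
Qed.

Lemma is_matchE p n (tau : 'S_p) (s : 'S_n) i : (0 < p)%N ->
  is_match tau s i = begins tau (drop i (word s)).
Proof.
move=> p_gt0; rewrite /is_match -/(begins _ _); apply: andb_idl => /begins_size.
by rewrite size_drop size_word; lia.
Qed.

Lemma begins_drop_eq p (tau : 'S_p) u v i :
  u = red v -> begins tau (drop i u) = begins tau (drop i v).
Proof.
move=> ->; rewrite /red -map_drop; apply: begins_order_invariant.
exact: sub_mono (@mem_drop _ _ _) (@red_mono v).
Qed.

(** * Shifts between overlapping occurrences *)

Section Overlap.

Variable p : nat.
Hypothesis p_gt0 : (0 < p)%N.

(** The definition asks for exactly two matches, so the least positive shift [j] is taken and the
    word is cut where that occurrence ends. Its reduction has length [j + p] and matches only at 0
    and [j], whence [2 * p - 1 <= j + p]. *)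
Lemma minimal_overlapping_shift (tau : 'S_p) (w : seq nat) i :
  minimal_overlapping tau -> uniq w -> (0 < i)%N ->
  begins tau w -> begins tau (drop i w) -> (p.-1 <= i)%N.
Proof.
move=> [_ min_tau] Uw i_gt0 tau0 tau_i.
have ex_i : exists j, (0 < j)%N && begins tau (drop j w) by exists i; apply/andP.
case: (ex_minnP ex_i) => j /andP[j_gt0 tau_j] min_j.
suff: (p.-1 <= j)%N by move/leq_trans; apply; apply: min_j; apply/andP.
have le_jw : (j + p <= size w)%N.
  by have := begins_size tau_j; rewrite size_drop; lia.
have [s red_s] := @red_is_word (j + p) (take (j + p) w) (size_takel le_jw) (take_uniq _ Uw).
have match_s k : is_match tau s k = (k <= j)%N && begins tau (drop k w).
  rewrite is_matchE // (begins_drop_eq _ _ red_s).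
  have [le_kj|lt_jk] /= := leqP k j.
    have -> : (j + p = (j - k + p) + k)%N by lia.
    by rewrite -take_drop begins_take leq_addl.
  apply: contraTF lt_jk => /begins_size; rewrite size_drop size_takel //; lia.
suff /min_tau : exists s : 'S_(j + p), n_matches tau s = 2 by lia.
exists s; rewrite /n_matches.
have -> : [set k : 'I_(j + p).+1 | is_match tau s k] = [set inord 0; inord j].
  apply/setP => k; rewrite !inE match_s -!val_eqE /= !inordK //; last lia.
  apply/andP/orP => [[le_kj tau_k]|[/eqP->|/eqP->]].
  - case: (posnP k) => [->|k_gt0]; [by left|right].
    by rewrite eqn_leq le_kj min_j // k_gt0.
  - by rewrite drop0.
  - by [].
by rewrite cards2 -val_eqE /= !inordK ?(gtn_eqF j_gt0) //; lia.
Qed.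

(** The word cut where the occurrence of [rho] ends contains both patterns, so
    [2 * p - 1 <= i + p]. *)
Lemma mutually_minimal_overlapping_shift (tau rho : 'S_p) (w : seq nat) i :
  mutually_minimal_overlapping tau rho -> uniq w ->
  begins tau w -> begins rho (drop i w) -> (p.-1 <= i)%N.
Proof.
move=> [_ _ [_ min_tr]] Uw tau0 rho_i.
have le_iw : (i + p <= size w)%N.
  by have := begins_size rho_i; rewrite size_drop; lia.
have [s red_s] := @red_is_word (i + p) (take (i + p) w) (size_takel le_iw) (take_uniq _ Uw).
suff /min_tr : exists s : 'S_(i + p), 
    (1 <= n_matches tau s)%N /\ (1 <= n_matches rho s)%N by lia.
exists s; split; apply/card_gt0P.
  exists (inord 0); rewrite inE is_matchE // inordK // (begins_drop_eq _ _ red_s).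
  by rewrite drop0 begins_take leq_addl.
exists (inord i); rewrite inE is_matchE // inordK ?(begins_drop_eq _ _ red_s); last lia.
by rewrite addnC -take_drop begins_take leqnn.
Qed.

End Overlap.

Lemma fps_inv_unique (K : fieldType) (f g : nat -> K) : f 0%N != 0 ->
  (forall n, fps_mul f g n = (n == 0%N)%:R) -> forall n, g n = fps_inv f n.
Proof.
move=> f0 fg n; have [m le_nm] := ubnP n; elim: m n le_nm => // m IHm n le_nm.
have := fg n; rewrite -(fps_mulV n f0) /fps_mul !big_ord_recr /= subnn.
rewrite (eq_bigr (fun i : 'I_n => f (n - i)%N * fps_inv f i)) => [/addrI/(mulfI f0) //|i _].
by rewrite IHm //; apply: leq_trans (ltn_ord i) _.
Qed.

(** * Chains of tiles on a fixed word *)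

Section Chains.

Variables (K : fieldType) (z : K) (p : nat) (Gamma : {set 'S_p}).
Hypothesis p_gt2 : (2 < p)%N.
Hypothesis overlapP : forall (tau rho : 'S_p) (w : seq nat) (i : nat),
  tau \in Gamma -> rho \in Gamma -> uniq w -> (0 < i)%N ->
  begins tau w -> begins rho (drop i w) -> (p.-1 <= i)%N.

Definition begins_set (w : seq nat) : bool := [exists tau in Gamma, begins tau w].

Fixpoint avoids (w : seq nat) : bool :=
  if w is _ :: r then ~~ begins_set w && avoids r else true.

Definition avoid_weight (w : seq nat) : K :=
  if w is [::] then 1 else (avoids w)%:R * z ^+ (descents w + 1).

Lemma avoid_weightE w : w != [::] ->
  avoid_weight w = (avoids w)%:R * z ^+ (descents w + 1).
Proof. by case: w. Qed.

(* The recursion on w jumps p.-1 letters at a time, hence the fuel m. *)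
Fixpoint chain_rec (m : nat) (w : seq nat) : K :=
  if m is m'.+1 then
    if w is x :: r then
      if r is y :: _ then
        (1 - z) * (x <= y)%N%:R * chain_rec m' r
        - \sum_(tau in Gamma)
            (begins tau w)%:R * z ^+ n_descents tau * chain_rec m' (drop p.-1 w)
      else 1
    else 0
  else 0.

Lemma chain_rec_cons m x y r (w := [:: x, y & r]) :
  chain_rec m.+1 w
  = (1 - z) * (x <= y)%N%:R * chain_rec m (y :: r)
    - \sum_(tau in Gamma)
        (begins tau w)%:R * z ^+ n_descents tau * chain_rec m (drop p.-1 w).
Proof. by []. Qed.

Arguments chain_rec : simpl never.

(* The weight of all ways to tile the adjacencies of w by ascents, of weight
   1 - z, and by marked occurrences of some tau in Gamma, each covering p.-1
   adjacencies and of weight - z ^+ n_descents tau. *)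
Definition chain_weight (w : seq nat) : K := chain_rec (size w) w.

Lemma chain_recE m w : (size w <= m)%N -> chain_rec m w = chain_weight w.
Proof.
rewrite /chain_weight; move: {2 4}(size w) (leqnn (size w)) => m' le_m' le_m.
elim: m m' w le_m' le_m => [|m IHm] [|m'] [|x [|y r]] // le_m' le_m.
have le_drop k : (size (y :: r) <= k)%N -> (size (drop p.-1 (x :: y :: r)) <= k)%N.
  by rewrite size_drop /=; lia.
rewrite !chain_rec_cons; congr (_ * _ - _); first exact: IHm.
by apply: eq_bigr => tau _; congr (_ * _); apply: IHm; apply: le_drop.
Qed.

Lemma chain_weight1 x : chain_weight [:: x] = 1.
Proof. by []. Qed.

Lemma chain_weight_cons x y r :
  chain_weight [:: x, y & r] = (1 - z) * (x <= y)%N%:R * chain_weight (y :: r)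
    - \sum_(tau in Gamma) (begins tau [:: x, y & r])%:R * z ^+ n_descents tau
        * chain_weight (drop p.-1 [:: x, y & r]).
Proof.
rewrite {1}/chain_weight chain_rec_cons; congr (_ - _); apply: eq_bigr => tau _.
congr (_ * _); apply: (chain_recE (m := size (y :: r))).
by rewrite size_drop /=; lia.
Qed.

Lemma chain_weight_order_invariant : order_invariant chain_weight.
Proof.
move=> h w; rewrite /chain_weight size_map; move: (size w) => m.
elim: m w => [|m IHm] [|x [|y r]] // mh; rewrite !map_cons !chain_rec_cons.
congr (_ - _).
  rewrite mh ?inE ?eqxx ?orbT //; congr (_ * _).
  by apply: (IHm (y :: r)); apply: sub_mono mh => a; rewrite !inE => ->; rewrite orbT.
apply: eq_bigr => tau _; congr ((nat_of_bool _)%:R * _ * _).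
  by rewrite -(begins_order_invariant tau mh).
by rewrite -[RHS]IHm ?map_drop //; apply: sub_mono mh; apply: mem_drop.
Qed.

Lemma begins_inj (tau rho : 'S_p) w : begins tau w -> begins rho w -> tau = rho.
Proof. by move=> /eqP eq1 /eqP eq2; apply: word_inj; rewrite -eq1. Qed.

Lemma begins_set_order_invariant : order_invariant begins_set.
Proof.
by move=> h w mh; apply: eq_existsb => tau; rewrite (begins_order_invariant tau mh).
Qed.

Lemma avoids_order_invariant : order_invariant avoids.
Proof.
move=> h; elim=> // x r IHr mh; rewrite [LHS]/= [RHS]/= (begins_set_order_invariant mh).
by rewrite IHr //; apply: sub_mono mh => a; rewrite !inE => ->; rewrite orbT.
Qed.

Lemma avoid_weight_order_invariant : order_invariant avoid_weight.
Proof.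
move=> h [|x r] // mh; rewrite /avoid_weight.
by rewrite -(avoids_order_invariant mh) -(descents_order_invariant mh).
Qed.

Lemma begins_nil (tau : 'S_p) : begins tau [::] = false.
Proof. by apply/negP => /begins_size; rewrite leqn0; lia. Qed.

Lemma begins_set_nil : begins_set [::] = false.
Proof. by apply/existsP => -[tau]; rewrite begins_nil andbF. Qed.

Lemma avoidsP w : reflect (forall i, ~~ begins_set (drop i w)) (avoids w).
Proof.
elim: w => [|x r IHr] /=; first by constructor=> i; rewrite begins_set_nil.
apply: (iffP andP) => [[x_r /IHr avr] [|i]|av]; [exact: x_r|exact: avr|].
split; first exact: (av 0%N).
by apply/IHr => i; apply: (av i.+1).
Qed.

Lemma avoids_drop i j w : (i <= j)%N ->
  (forall k, (i <= k < j)%N -> ~~ begins_set (drop k w)) ->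
  avoids (drop i w) = avoids (drop j w).
Proof.
move=> le_ij nb; apply/avoidsP/avoidsP => av k; rewrite drop_drop.
  by have := av (k + j - i)%N; rewrite drop_drop subnK //; lia.
have [lt_kj|le_jk] := ltnP (k + i) j; first by apply: nb; lia.
by have := av (k + i - j)%N; rewrite drop_drop subnK.
Qed.

(** A prefix of length [l.+1] contains the occurrence only if [p.-1 <= l]. Writing [l] as [p.-1]
    plus a new index turns cuts of [w] into cuts of what is left after the first tile. *)
Lemma sum_begins_take (tau : 'S_p) (w : seq nat) (f g : seq nat -> K) :
  \sum_(l < size w) (begins tau (take l.+1 w))%:R * f (drop p.-1 (take l.+1 w))
                    * g (drop l.+1 w)
  = (begins tau w)%:R * \sum_(l < size (drop p.-1 w))
      f (take l.+1 (drop p.-1 w)) * g (drop l.+1 (drop p.-1 w)).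
Proof.
case tau_w: (begins tau w); last first.
  by rewrite mul0r big1 // => l _; rewrite begins_take tau_w andbF !mul0r.
have le_pw := begins_size tau_w.
have -> : size w = (p.-1 + size (drop p.-1 w))%N by rewrite size_drop; lia.
rewrite mul1r big_split_ord /= [X in X + _]big1 ?add0r => [|l _]; last first.
  have lt_lp := ltn_ord l; rewrite begins_take /=.
  by case: leqP => [|_]; rewrite ?mul0r //; lia.
apply: eq_bigr => l _ /=; rewrite begins_take tau_w.
case: leqP => [lt_p|]; last by lia.
by rewrite mul1r take_drop drop_drop addSn addnC.
Qed.

(* Both sides are computed by removing the first tile of the chain. *)
Lemma avoid_weight_chain (w : seq nat) : uniq w -> w != [::] ->
  avoid_weight w
  = z * \sum_(l < size w) chain_weight (take l.+1 w) * avoid_weight (drop l.+1 w).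
Proof.
have [n le_wn] := ubnP (size w); elim: n w le_wn => // n IHn [|x [|y r]] // le_wn Uw _.
  rewrite big_ord1 /= chain_weight1 mul1r mulr1 /avoid_weight /= ltnn.
  have -> : begins_set [:: x] = false.
    by apply/existsP => -[tau /andP[_ /begins_size /=]]; lia.
  by rewrite mul1r expr1.
set w := [:: x, y & r].
have Ur : uniq (y :: r) by case/andP: Uw.
have IHr := IHn (y :: r) le_wn Ur isT.
(* The index [l] = 0 is the one-letter chain; for longer chains [chain_weight_cons] removes the
   first tile. *)
have sum_w : \sum_(l < size w) chain_weight (take l.+1 w) * avoid_weight (drop l.+1 w)
  = avoid_weight (y :: r)
    + (1 - z) * (x <= y)%N%:R * (\sum_(l < size (y :: r))
         chain_weight (take l.+1 (y :: r)) * avoid_weight (drop l.+1 (y :: r)))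
    - \sum_(tau in Gamma) (begins tau w)%:R * z ^+ n_descents tau *
        \sum_(l < size (drop p.-1 w)) chain_weight (take l.+1 (drop p.-1 w))
            * avoid_weight (drop l.+1 (drop p.-1 w)).
  transitivity (avoid_weight (y :: r) + \sum_(l < size (y :: r))
     ((1 - z) * (x <= y)%N%:R * chain_weight (take l.+1 (y :: r))
      - \sum_(tau in Gamma) (begins tau (take l.+2 w))%:R * z ^+ n_descents tau *
        chain_weight (drop p.-1 (take l.+2 w))) * avoid_weight (drop l.+2 w)).
    rewrite big_ord_recl [take _ _]/= chain_weight1 mul1r [drop _ _]/=.
    by congr (_ + _); apply: eq_bigr => l _; rewrite -chain_weight_cons.
  rewrite -addrA; congr (_ + _); under eq_bigr do rewrite mulrBl mulr_suml.
  rewrite sumrB mulr_sumr; congr (_ - _).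
    by apply: eq_bigr => l _; rewrite mulrA.
  rewrite exchange_big; apply: eq_bigr => tau _ /=.
  rewrite [_ * z ^+ _]mulrC -mulrA -sum_begins_take mulr_sumr.
  rewrite [RHS]big_ord_recl begins_take [(p <= _)%N]leqNgt.
  have -> /= : (1 < p)%N by lia.
  rewrite !mul0r mulr0 add0r; apply: eq_bigr => l _ /=.
  by rewrite !mulrA [_ * z ^+ _]mulrC.
rewrite {}sum_w mulrBr mulrDr [z * (_ * _ * _)]mulrCA -IHr.
(* A descent contributes the factor [z], an ascent [z + (1 - z) = 1]. *)
have -> : z * avoid_weight (y :: r) + (1 - z) * (x <= y)%N%:R * avoid_weight (y :: r)
        = (avoids (y :: r))%:R * z ^+ (descents w + 1).
  rewrite /w /avoid_weight [descents (x :: _)]/=.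
  by case: leqP => _; rewrite /= ?add1n ?add0n ?addSn ?exprS; ring.
have av_w : avoids w = ~~ begins_set w && avoids (y :: r) by [].
have [/existsP[tau /andP[tauG tau_w]]|nw] := boolP (begins_set w); last first.
  rewrite big1 => [|tau tauG]; last first.
    case: (boolP (begins tau w)) => [tau_w|_]; last by rewrite !mul0r.
    by case/existsP: nw; exists tau; rewrite tauG.
  by rewrite mulr0 subr0 avoid_weightE // av_w nw.
have -> : avoid_weight w = 0.
  rewrite avoid_weightE // av_w.
  have -> : begins_set w by apply/existsP; exists tau; rewrite tauG.
  by rewrite mul0r.
have le_pw : (p <= size w)%N := begins_size tau_w.
have nz_d : drop p.-1 w != [::].
  by rewrite -size_eq0 size_drop -lt0n subn_gt0 prednK // ltnW // ltnW.
have lt_d : (size (drop p.-1 w) < n)%N.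
  by rewrite size_drop; move: le_wn; rewrite -[size _]/(size w); lia.
(* By [overlapP] no occurrence starts at a position [k] with [0 < k < p.-1], so these positions can
   be skipped. *)
have -> : avoids (y :: r) = avoids (drop p.-1 w).
  rewrite -[y :: r]/(drop 1 w); apply: avoids_drop => [|k /andP[k_gt0 lt_kp]]; first lia.
  apply/existsP => -[rho /andP[rhoG rho_w]].
  by have := overlapP tauG rhoG Uw k_gt0 tau_w rho_w; rewrite leqNgt lt_kp.
have -> : descents w = (n_descents tau + descents (drop p.-1 w))%N.
  rewrite (@descents_split p.-1) ?prednK //; last lia; last lia.
  congr (_ + _)%N; rewrite n_descents_word -(eqP tau_w).
  by rewrite (order_invariant_red _ descents_order_invariant).
(* No other pattern begins [w], and by induction the term of [tau] cancels what the ascents and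
   descents contributed. *)
rewrite (bigD1 tau) //=.
rewrite [\sum_(i in Gamma | i != tau) _]big1 => [|rho /andP[_ ne_rho]]; last first.
  case: (boolP (begins rho w)) => [rho_w|_]; last by rewrite !mul0r.
  by rewrite (begins_inj rho_w tau_w) eqxx in ne_rho.
rewrite tau_w mul1r addr0 mulrCA -IHn ?drop_uniq //.
rewrite avoid_weightE // -addnA exprD; ring.
Qed.

Hypothesis first_letter : forall tau : 'S_p, tau \in Gamma -> head 0%N (word tau) = 1%N.

Lemma begins_head_min (tau : 'S_p) x r : tau \in Gamma -> begins tau (x :: r) ->
  all (fun y => x < y)%N (take p.-1 r).
Proof.
move=> tauG /eqP tau_w; have := first_letter tauG; rewrite -tau_w.
rewrite -[p in take p]prednK; last by lia.
rewrite /= leqnn add1n => -[c0].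
rewrite all_count -(count_predC (fun y => y <= x)%N) c0 add0n.
by apply/eqP/eq_count => y /=; rewrite ltnNge.
Qed.

(** A nonzero weight requires a tiling. Successive tiles share an end letter and each starts with
    its least letter, so the first letters of the tiles never decrease. *)
Lemma chain_weight_head_min x r : chain_weight (x :: r) != 0 ->
  all (fun y => x <= y)%N r.
Proof.
have [n le_rn] := ubnP (size r); elim: n x r le_rn => // n IHn x [|y r] // le_rn.
set w := [:: x, y & r]; rewrite chain_weight_cons -/w => nz_w.
have [le_xy | lt_yx] := boolP ((x <= y)%N && (chain_weight (y :: r) != 0)).
  case/andP: le_xy => le_xy /IHn; rewrite /= le_xy => /(_ le_rn).
  by apply: sub_all => t; apply: leq_trans.
have [tau /andP[tauG /andP[tau_w nz_tau]]] : exists tau,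
    (tau \in Gamma) && (begins tau w && (chain_weight (drop p.-1 w) != 0)).
  apply/existsP; apply: contraNT nz_w => /existsPn no_tau.
  rewrite big1 ?subr0 => [|tau tauG].
    move: lt_yx; rewrite negb_and negbK => /orP[/negPf->|/eqP->]; last by rewrite mulr0.
    by rewrite mulr0 mul0r.
  have := no_tau tau; rewrite tauG /= negb_and negbK => /orP[/negPf->|/eqP->].
    by rewrite !mul0r.
  by rewrite mulr0.
have le_pw : (p <= size w)%N := begins_size tau_w.
have minw := begins_head_min tauG tau_w.
(* Position [p.-2] of [y :: r] holds the last letter of the occurrence, which exceeds [x] and starts
   the rest of the chain. *)
have dropE : drop p.-1 w = drop p.-2 (y :: r) by rewrite -[p.-1]prednK //; lia.
have p2 : (p.-2 < size (y :: r))%N by move: le_pw => /=; lia.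
have lt_x : (x < nth 0 (y :: r) p.-2)%N.
  apply: (allP minw); rewrite -(@nth_take p.-1) ?mem_nth //; last lia.
  by rewrite size_take; case: (ltnP p.-1) => _ //; lia.
move: nz_tau; rewrite dropE (drop_nth 0%N p2) => /IHn min_d.
have {}min_d : all (fun y => x <= y)%N (drop p.-1 (y :: r)).
  have -> : p.-1 = p.-2.+1 by lia.
  apply: sub_all (min_d _) => [t|]; first exact/leq_trans/ltnW.
  by rewrite size_drop; move: le_rn => /=; lia.
rewrite -(cat_take_drop p.-1 (y :: r)) all_cat min_d andbT.
by apply: sub_all minw => t; apply: ltnW.
Qed.

(** * Sums of chain weights over all permutations, and their recurrence *)

Variable q : K.
Hypothesis qfact_neq0 : forall n, qfact q n != 0.

Definition chain_sum (n : nat) : K := word_sum q n n chain_weight.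

Lemma chain_weight_zero_first n (w : seq nat) (i := head 0%N w) :
  size w = n -> uniq w -> all (fun x => x < n)%N w -> (0 < i)%N -> chain_weight w = 0.
Proof.
move=> sw Uw ltw i_gt0; apply/eqP; apply: contraTT i_gt0 => nz_w.
have : 0%N \in w.
  rewrite (perm_mem (perm_eq_iota sw Uw ltw)) mem_iota -sw.
  by case: (w) nz_w; rewrite ?eqxx.
case: w @i nz_w {sw Uw ltw} => //= x r /chain_weight_head_min min_x.
by rewrite inE -leqNgt leqn0 eq_sym => /orP[//|/(allP min_x)]; rewrite leqn0.
Qed.

Lemma chain_sumS n :
  chain_sum n.+1 = word_sum q n n (fun w => chain_weight (0%N :: map S w)).
Proof.
rewrite /chain_sum word_sumS big_ord_recl big1 ?addr0 => [|i _].
  by rewrite expr0 mul1r.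
rewrite (@eq_word_sum _ _ _ _ _ (fun=> 0)) ?word_sum0 ?mulr0 // => w sw Uw ltw.
apply: (@chain_weight_zero_first n.+1) => //=; rewrite ?size_map ?sw //.
  rewrite map_inj_uniq ?Uw ?andbT; last exact: can_inj (bumpK _).
  by apply/mapP => -[x _]; rewrite /bump /=; lia.
rewrite (ltn_ord (lift ord0 i)) all_map; apply: sub_all ltw => x /=.
by rewrite /bump; lia.
Qed.

Lemma chain_sum1 : chain_sum 1 = 1.
Proof. by rewrite chain_sumS /= chain_weight1. Qed.

(** If the first letter is not 0, then 0 lies in the rest, which as a chain must start with it, and
    the ascent fails. A first letter 0 adds no inversions. *)
Lemma word_sum_ascent n :
  word_sum q n.+2 n.+2 (fun w => (head 0%N w <= head 0%N (behead w))%N%:R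
                                 * chain_weight (behead w))
  = chain_sum n.+1.
Proof.
rewrite word_sumS big_ord_recl big1 ?addr0 => [|i _].
  rewrite expr0 mul1r; apply: eq_word_sum => w _ _ _ /=.
  by rewrite mul1r (order_invariant_map (@bump_mono 0) chain_weight_order_invariant).
rewrite (@eq_word_sum _ _ _ _ _ (fun=> 0)) ?word_sum0 ?mulr0 //= => w sw Uw ltw.
rewrite (order_invariant_map (@bump_mono _) chain_weight_order_invariant).
have [w_gt0|w_eq0] := posnP (head 0%N w); last first.
  by rewrite (chain_weight_zero_first sw Uw ltw) ?mulr0.
by case: w sw w_gt0 {Uw ltw} => //= x w _ ->; rewrite /bump /= mul0r.
Qed.

Lemma last_word_bounds (tau : 'S_p) : (0 < last 0%N (word tau) <= p)%N.
Proof.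
have p_gt0 : (0 < p)%N by lia.
rewrite -nth_last size_word; have lt_p : (p.-1 < p)%N by lia.
by rewrite (nth_word _ (Ordinal lt_p)) ltn_ord.
Qed.

(** The chain that follows has the last letter of the occurrence as its least letter. So all smaller
    letters lie in the occurrence, and the value of the shared letter is its rank there, [s.-1] when
    counted from 0. This is the situation of [word_sum_last]. *)
Lemma word_sum_begins (tau : 'S_p) n : tau \in Gamma ->
  word_sum q n n (fun w => (begins tau w)%:R * chain_weight (drop p.-1 w))
  = if (n < p)%N then 0 else
      q ^+ n_inversions tau
      * qbinom q (n - last 0%N (word tau)) (p - last 0%N (word tau))
      * chain_sum (n - p + 1).
Proof.
move=> tauG; case: ltnP => [lt_np|le_pn].
  rewrite (@eq_word_sum _ _ _ _ _ (fun=> 0)) ?word_sum0 // => w sw _ _.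
  case: (boolP (begins tau w)) => [/begins_size|_]; rewrite ?mul0r //.
  by rewrite sw leqNgt lt_np.
have := last_word_bounds tau; set s := last 0%N (word tau) => /andP[s_gt0 le_sp].
pose F u : K := (red u == word tau)%:R.
(* Replacing the shared letter by 0 makes the weight of the rest depend on [drop p w] alone, so that
   the sum factors. *)
pose G w := chain_weight (0%N :: map S w).
have iF : order_invariant F.
  by move=> h u mh; rewrite /F red_order_invariant.
have iG : order_invariant G.
  move=> h w mh; have := order_invariant_insert0 0 chain_weight_order_invariant mh.
  by rewrite /insert_at !take0 !drop0.
have rF u : size u = p -> uniq u -> F u != 0 ->
    count (fun x => x < last 0 u)%N u = s.-1.
  rewrite /F; case: (red u =P word tau) => [red_u|_]; last by rewrite eqxx.
  case: u red_u => [|x u] red_u su Uu _; first by move: su => /=; lia.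
  pose f t := count (fun y => y <= t)%N (x :: u).
  have -> : s = f (last x u) by rewrite /s -red_u -(last_map f).
  by rewrite /f count_leq_ltn ?mem_last.
transitivity (word_sum q n n (fun w =>
    (if last 0%N (take p w) == s.-1 then F (take p w) else 0) * G (drop p w))).
  apply: eq_word_sum => w sw Uw ltw.
  case tau_w: (begins tau w); last first.
    by rewrite mul0r /F -/(begins tau w) tau_w if_same mul0r.
  have le_pw := begins_size tau_w.
  have F1 : F (take p w) = 1 by rewrite /F -/(begins tau w) tau_w.
  rewrite F1 mul1r.
  set x := last 0%N (take p w); set B := drop p w.
  have drop_w : drop p.-1 w = x :: B.
    rewrite (drop_nth 0%N) ?prednK //; try lia.
    by rewrite /x -nth_last size_takel // nth_take ?prednK //; lia.
  have xw : x \in w by apply: (@mem_drop p.-1); rewrite drop_w mem_head.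
  (* All letters below [n] occur in [w], so exactly [x] of them are smaller than [x]: [s.-1] in the
     occurrence and the others in [B]. *)
  have rank_x : (s.-1 + count (fun y => y < x) B)%N = x.
    rewrite -(rF (take p w)) ?F1 ?oner_eq0 ?take_uniq ?size_takel //.
    rewrite -count_cat cat_take_drop (seq.permP (perm_eq_iota sw Uw ltw)).
    by rewrite count_ltn_iota //; apply/ltnW/(allP ltw).
  have UxB : uniq (x :: B) by rewrite -drop_w drop_uniq.
  rewrite drop_w; case: eqP => [eq_x|ne_x]; last first.
    rewrite mul0r; apply/eqP; apply: contra_notT ne_x => /chain_weight_head_min min_x.
    rewrite -{1}rank_x (eq_in_count (a2 := pred0)) ?count_pred0 ?addn0 // => y By /=.
    by apply/negbTE; rewrite -leqNgt (allP min_x).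
  have cB : count (fun y => y < x)%N B = 0 by lia.
  have minB y : y \in B -> (x < y)%N.
    move=> By; rewrite ltn_neqAle; apply/andP; split.
      by apply: contraTneq UxB => ->; rewrite /= By.
    rewrite leqNgt; apply: contra_eqN cB => lt_yx.
    by rewrite -lt0n -has_count; apply/hasP; exists y.
  rewrite mul1r /G.
  (* As [x] lies below all of [B], sending it to 0 and shifting the rest preserves the order. *)
  rewrite -(chain_weight_order_invariant (h := fun y => if y == x then 0%N else y.+1)).
    rewrite /= eqxx; congr (chain_weight (_ :: _)); apply/eq_in_map => y /minB.
    by case: ltngtP.
  move=> a b; rewrite !inE => /orP[/eqP->|/minB lt_a] /orP[/eqP->|/minB lt_b];
    rewrite ?eqxx ?(gtn_eqF lt_a) ?(gtn_eqF lt_b) ?leqnn //.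
    by rewrite (ltnW lt_b).
  by rewrite [RHS]leqNgt lt_a.
rewrite (word_sum_take_drop q (fun u => if last 0%N u == s.-1 then F u else 0)) //.
rewrite word_sum_last // ?prednK ?s_gt0 ?le_sp //.
rewrite addn1 chain_sumS; congr (_ * _); rewrite mulrC; congr (_ * _).
(* Among the permutations of length [p], [F] selects [tau] alone, leaving
   [q ^+ n_inversions tau]. *)
transitivity (word_sum q p p (fun w => F (map S w))).
  by apply: eq_word_sum => w _ _ _; rewrite (order_invariant_map _ iF).
rewrite -sum_perm_word (bigD1 tau) //= big1 ?addr0 => [|rho ne_rho].
  by rewrite /F red_word eqxx mulr1.
by rewrite /F red_word (inj_eq (@word_inj p)) (negPf ne_rho) mulr0.
Qed.

Lemma chain_sum_rec n : chain_sum n.+2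
  = (1 - z) * chain_sum n.+1
    - \sum_(tau in Gamma) (if (n.+2 < p)%N then 0 else
        z ^+ n_descents tau * q ^+ n_inversions tau
        * qbinom q (n.+2 - last 0%N (word tau)) (p - last 0%N (word tau))
        * chain_sum (n.+2 - p + 1)).
Proof.
rewrite {1}/chain_sum.
rewrite (@eq_word_sum _ _ _ _ _ (fun w =>
    (1 - z) * ((head 0%N w <= head 0%N (behead w))%N%:R * chain_weight (behead w))
    + \sum_(tau in Gamma) - z ^+ n_descents tau
        * ((begins tau w)%:R * chain_weight (drop p.-1 w)))); last first.
  move=> [|x [|y r]] //= _ _ _; rewrite chain_weight_cons -mulrA -sumrN; congr (_ + _).
  by apply: eq_bigr => tau _; rewrite mulNr mulrA [_ * z ^+ _]mulrC.
rewrite word_sumD word_sumZ word_sum_ascent word_sum_sum -sumrN; congr (_ + _).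
apply: eq_bigr => tau tauG; rewrite word_sumZ word_sum_begins //.
by case: ifP => _; rewrite ?mulr0 ?oppr0 // mulNr !mulrA.
Qed.

(** * The series [INM_series] and its reciprocal *)

Lemma INM_word_sum n : INM_series q z Gamma n = word_sum q n n avoid_weight / qfact q n.
Proof.
rewrite /INM_series; case: eqP => [->|/eqP n_gt0]; first by rewrite qfact0 divr1.
congr (_ / _); transitivity (word_sum q n n (fun w => avoid_weight (map S w))); last first.
  apply: eq_word_sum => w _ _ _.
  by rewrite (order_invariant_map _ avoid_weight_order_invariant).
rewrite -sum_perm_word /INM big_mkcond /=; apply: eq_bigr => s _.
rewrite avoid_weightE -?size_eq0 ?size_word // n_descents_word.
have -> : (s \in NM Gamma n) = avoids (word s).
  rewrite inE; apply/forallP/avoidsP => [nm i|av i]; last first.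
    apply: contra (av i) => /existsP[tau tau_i]; apply/existsP; exists tau.
    by rewrite -is_matchE //; lia.
  have [lt_in|le_ni] := ltnP i n.+1; last first.
    by rewrite drop_oversize ?begins_set_nil // size_word ltnW.
  apply: contra (nm (Ordinal lt_in)) => /existsP[tau tau_i]; apply/existsP; exists tau.
  by rewrite is_matchE //; lia.
by case: ifP => _; rewrite ?mul0r ?mulr0 ?mul1r // mulrC.
Qed.

(** This sums [avoid_weight_chain] over all words. The prefix brings a factor [qbinom q n l.+1],
    which divided by [qfact q n] leaves one q-factorial denominator for each piece. *)
Lemma INM_chain_sum n : (0 < n)%N -> INM_series q z Gamma n
  = z * \sum_(l < n) chain_sum l.+1 / qfact q l.+1 * INM_series q z Gamma (n - l.+1).
Proof.
move=> n_gt0; rewrite INM_word_sum.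
rewrite (@eq_word_sum _ _ _ _ _ (fun w => z * \sum_(l < n)
    chain_weight (take l.+1 w) * avoid_weight (drop l.+1 w))); last first.
  move=> w sw Uw _; rewrite avoid_weight_chain //; first by rewrite sw.
  by rewrite -size_eq0 sw -lt0n.
rewrite word_sumZ -mulrA; congr (_ * _); rewrite word_sum_sum mulr_suml.
apply: eq_bigr => l _; rewrite word_sum_take_drop //; last exact: avoid_weight_order_invariant.
rewrite word_sum_qbinom //; last exact: chain_weight_order_invariant.
rewrite INM_word_sum /qbinom ltn_ord -/(chain_sum _).
have [n1 [n2 n3]] := (qfact_neq0 n, (qfact_neq0 l.+1, qfact_neq0 (n - l.+1)%N)).
by field; rewrite n1 n2 n3.
Qed.

Lemma IU_chain_sum n : (0 < n)%N -> IU q z Gamma n = - z * chain_sum n.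
Proof.
(* [g] lists the coefficients of 1 minus [z] times the chain series; [INM_chain_sum] says that its
   product with [INM_series] is 1. *)
move=> n_gt0; pose g n := if n == 0%N then 1 else - z * chain_sum n / qfact q n.
have f0 : INM_series q z Gamma 0 != 0 by rewrite oner_eq0.
rewrite /IU -(@fps_inv_unique _ _ g) //.
  by rewrite /g (gtn_eqF n_gt0) divfK.
move=> m; rewrite /fps_mul big_ord_recl subn0 /g /= mulr1; case: (posnP m) => [->|m_gt0].
  by rewrite big_ord0 addr0.
rewrite {1}INM_chain_sum // mulr_sumr -big_split big1 //= => l _.
rewrite /bump /= add1n; ring.
Qed.

Lemma IU1 : IU q z Gamma 1 = - z.
Proof. by rewrite IU_chain_sum // chain_sum1 mulr1. Qed.

Lemma IU_rec n : IU q z Gamma n.+2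
  = (1 - z) * IU q z Gamma n.+1
    - \sum_(tau in Gamma) (if (n.+2 < p)%N then 0 else
        z ^+ n_descents tau * q ^+ n_inversions tau
        * qbinom q (n.+2 - last 0%N (word tau)) (p - last 0%N (word tau))
        * IU q z Gamma (n.+2 - p + 1)).
Proof.
have pos : (0 < n.+2 - p + 1)%N by rewrite addn1.
rewrite !IU_chain_sum // chain_sum_rec mulrBr mulrCA; congr (_ - _).
rewrite mulr_sumr; apply: eq_bigr => tau _; case: ifP => _; first by rewrite mulr0.
by rewrite mulrCA.
Qed.

End Chains.

Theorem theorem5p1 (p : nat) (Gamma : {set 'S_p})
    (hp : (3 <= p)%N)
    (hmin : forall alpha : 'S_p, alpha \in Gamma -> minimal_overlapping alpha)
    (hstart : forall alpha : 'S_p, alpha \in Gamma -> head 0%N (word alpha) = 1%N)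
    (hmutual : forall alpha beta : 'S_p,
       alpha \in Gamma -> beta \in Gamma -> alpha <> beta ->
       mutually_minimal_overlapping alpha beta) :
  IU q_ z_ Gamma 1 = - z_ /\
  forall n : nat, (2 <= n)%N ->
    IU q_ z_ Gamma n =
      (1 - z_) * IU q_ z_ Gamma (n - 1)%N
      - \sum_(alpha in Gamma)
          (if (n < p)%N then 0 else
             let s := last 0%N (word alpha) in
             z_ ^+ n_descents alpha * q_ ^+ n_inversions alpha * qbinom q_ (n - s)%N (p - s)%N
             * IU q_ z_ Gamma (n - p + 1)%N).
Proof.
have p_gt0 : (0 < p)%N by lia.
(* Equal patterns fall under minimal overlapping, distinct ones under mutual minimal overlapping. *)
have overlapP (tau rho : 'S_p) (w : seq nat) i : tau \in Gamma -> rho \in Gamma ->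
    uniq w -> (0 < i)%N -> begins tau w -> begins rho (drop i w) -> (p.-1 <= i)%N.
  move=> tauG rhoG Uw i_gt0 tau_w; case: (tau =P rho) => [<-|ne_tr].
    exact: minimal_overlapping_shift (hmin _ tauG) Uw i_gt0 tau_w.
  exact: mutually_minimal_overlapping_shift (hmutual _ _ tauG rhoG ne_tr) Uw tau_w.
split=> [|[|[|n]] // _]; first exact: (IU1 z_ hp overlapP hstart qfact_q_neq0).
by rewrite subSS subn0; exact: (IU_rec z_ hp overlapP hstart qfact_q_neq0).
Qed.
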